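(* Let $O_1,\dots,O_n$ be i.i.d. from $P_0$, and let $\hat\Psi$ be an estimator of $\Psi(P_0)\in\mathbb{R}$ satisfying $\hat\Psi-\Psi(P_0)=\bar D_n+R_{\mathrm{rem}}$ with $\bar D_n=\frac1n\sum_{i=1}^nD^*(O_i)$, where $D^*\in L^2_0(P_0)$, $\sigma^2_{\mathrm{EIF}}=\mathbb{E}_{P_0}[(D^* )^2]\in(0,\infty)$, $\|D^*\|_\infty\le M<\infty$ a.s., $R_{\mathrm{rem}}=O_P(n^{-1/2})$, and $R_{\mathrm{rem}}=r_n\xi_n$ with $r_n$ deterministic and $\xi_n=O_P(1)$. Let $T_n=\sqrt n(\hat\Psi-\Psi(P_0))$ and $T_n^*=\sqrt n(\hat\Psi^*-\hat\Psi)$, where $\hat\Psi^*$ is the estimator recomputed on a pairs bootstrap resample. Assume (i) $\sup_n\mathbb{E}[T_n^2]<\infty$, and (ii) $d_2\bigl(\mathcal L^*(T_n^*\mid\mathcal D_n),\mathcal L(T_n)\bigr)\xrightarrow{P}0$. Then, with the number of bootstrap resamples $B\to\infty$, $$\widehat{\mathrm{Var}}_{\mathrm{Boot}}(\hat\Psi)\xrightarrow{P}\mathrm{Var}\bigl(\hat\Psi-\Psi(P_0)\bigr),$$ where the limit is the full sampling variance $\sigma^2_{\mathrm{EIF}}/n+\mathrm{Var}(R_{\mathrm{rem}})+2\,\mathrm{Cov}(\bar D_n,R_{\mathrm{rem}})$.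
   Context: $\Psi:\mathcal P\to\mathbb R$ is a pathwise differentiable functional on a nonparametric model with efficient influence function $D^*$; $R_{\mathrm{rem}}$ is the second-order remainder, depending on the whole sample. $\mathcal D_n=\sigma(O_1,\dots,O_n)$; $d_2$ is the Mallows-2 (Wasserstein-2) distance between probability distributions on $\mathbb R$; $\mathcal L^*(\cdot\mid\mathcal D_n)$ is the conditional law given the data. Pairs bootstrap: $\{O_1^*,\dots,O_n^*\}$ is drawn with replacement from $\{O_1,\dots,O_n\}$, and $\hat\Psi^*$ is the estimator computed on this resample. With $B$ independent resamples giving $\hat\Psi^{(1)},\dots,\hat\Psi^{(B)}$, $$\widehat{\mathrm{Var}}_{\mathrm{Boot}}(\hat\Psi)=\frac1{B-1}\sum_{b=1}^B\bigl(\hat\Psi^{(b)}-\bar\Psi^*\bigr)^2,\qquad\bar\Psi^*=\frac1B\sum_{b=1}^B\hat\Psi^{(b)}.$$ The convergence means that the difference of the two sides converges to $0$ in probability. *)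

(* Defs.v *)
From HB Require Import structures.
From mathcomp Require Import all_boot all_order all_algebra.
From mathcomp Require Import all_classical all_reals all_analysis.
From mathcomp Require Import measurable_realfun.

Set Implicit Arguments.
Unset Strict Implicit.
Unset Printing Implicit Defensive.

Import Order.TTheory GRing.Theory Num.Theory.
Import numFieldNormedType.Exports.

Local Open Scope classical_set_scope.
Local Open Scope ring_scope.

Section pathwise_differentiability.
Context (R : realType) (d : measure_display) (X : measurableType d).
Implicit Types (P Q : probability X R) (s h D : X -> R).

Definition L20 P : set (X -> R) :=
  [set h | h \in Lfun P 2%:E /\ 'E_P[h]%E = 0%E].

Definition is_density (mu : {sigma_finite_measure set X -> \bar R}) Q
    (f : X -> R) : Prop :=
  [/\ measurable_fun [set: X] f, forall x, 0 <= f x &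
      forall A, measurable A -> Q A = (\int[mu]_(x in A) (f x)%:E)%E].

(* Differentiability in quadratic mean at t = 0 of the path t |-> p t, with
   score s.  The integral does not depend on the dominating measure [mu] nor on
   the densities, so the existential could equally be a universal. *)
Definition qmd P (p : R -> probability X R) s : Prop :=
  forall e : R, 0 < e -> \forall t \near 0^',
    exists (mu : {sigma_finite_measure set X -> \bar R}) (f g : X -> R),
      [/\ is_density mu (p t) f, is_density mu P g &
          (\int[mu]_x (((Num.sqrt (f x) - Num.sqrt (g x)) / t
              - s x * Num.sqrt (g x) / 2) ^+ 2)%:E < e%:E)%E].

Definition submodel (Mod : set (probability X R)) P
    (p : R -> probability X R) s : Prop :=
  [/\ p 0 = P, (\forall t \near (0 : R), Mod (p t)),
      s \in Lfun P 2%:E & qmd P p s].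

Definition tangent_set (Mod : set (probability X R)) P : set (X -> R) :=
  [set s | exists p, submodel Mod P p s].

(* The closure in L^2(P) of the linear span of the tangent set. *)
Definition tangent_space (Mod : set (probability X R)) P : set (X -> R) :=
  [set h | h \in Lfun P 2%:E /\
    forall e : R, 0 < e -> exists (k : nat) (c : 'I_k -> R)
      (s : 'I_k -> X -> R),
      (forall i, tangent_set Mod P (s i)) /\
      ('N[P]_2%:E[(fun x => (h x - \sum_(i < k) c i * s i x)%:E)] < e%:E)%E].

Definition nonparametric_at (Mod : set (probability X R)) P : Prop :=
  tangent_space Mod P = L20 P.

(* [Psi] is pathwise differentiable at [P] relative to [Mod], and [D] is the
   gradient of the derivative that lies in the tangent space. *)
Definition is_EIF (Mod : set (probability X R)) (Psi : probability X R -> R)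
    P D : Prop :=
  tangent_space Mod P D /\
  forall p s, submodel Mod P p s ->
    (Psi (p t) - Psi P) / t @[t --> 0^'] --> \int[P]_x (D x * s x).

End pathwise_differentiability.

Section probability_notions.
Context (R : realType) (d : measure_display) (Om : measurableType d).
Variable P : probability Om R.

Definition mutually_independent (K : eqType) (F : K -> set (set Om)) : Prop :=
  forall (J : seq K) (A : K -> set Om), uniq J ->
    (forall k, k \in J -> F k (A k)) ->
    P (\bigcap_(k in [set` J]) A k) = (\prod_(k <- J) P (A k))%E.

Definition iid (d' : measure_display) (X : measurableType d')
    (P0 : probability X R) (Obs : nat -> {RV P >-> X}) : Prop :=
  (forall i A, measurable A -> distribution P (Obs i) A = P0 A) /\
  mutually_independent
    (fun i => preimage_set_system [set: Om] (Obs i) measurable).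

Definition bigO_proba (Y : nat -> {RV P >-> R}) (a : nat -> R) : Prop :=
  forall e : R, 0 < e -> exists M : R, \forall n \near \oo,
    (P [set w | (M * a n < `|Y n w|)%R] <= e%:E)%E.

(* The outer measure makes this meaningful without a measurability assumption
   on [Y n]; on measurable events it coincides with [P]. *)
Definition cvg_proba0 (Y : nat -> Om -> \bar R) : Prop :=
  forall e : R, 0 < e ->
    (mu_ext P [set w | (e%:E < `|Y n w|)%E] @[n --> \oo] --> 0)%E.

(* [K] is a regular version of the conditional law of [Y] given the
   sigma-algebra [G]. *)
Definition is_cond_law (G : set (set Om)) (Y : Om -> R)
    (K : Om -> probability R R) : Prop :=
  forall A : set R, measurable A ->
    (forall Z : set (\bar R), measurable Z -> G ((fun w => K w A) @^-1` Z)) /\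
    forall E, G E -> (\int[P]_(w in E) K w A = P (E `&` Y @^-1` A))%E.

End probability_notions.

Section mallows.
Context (R : realType).
Implicit Types mu nu : set R -> \bar R.

Definition couplings mu nu : set (probability (R * R)%type R) :=
  [set pi : probability (R * R)%type R | forall A : set R, measurable A ->
     pi (fst @^-1` A) = mu A /\ pi (snd @^-1` A) = nu A].

Definition mallows2 mu nu : \bar R :=
  ereal_inf [set ('N[pi]_2%:E[(fun z => (z.1 - z.2)%:E)])%E
            | pi in couplings mu nu].

End mallows.

(* The sample of size n is Obs 0, ..., Obs (n - 1).  For each n, [idx n b j] is
   the position in that sample of the j-th draw of the b-th resample. *)
Section bootstrap.
Context (R : realType) (d d' : measure_display).
Context (Om : measurableType d) (X : measurableType d').
Variables (P : probability Om R) (Obs : nat -> {RV P >-> X}).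
Variable idx : forall n : nat, nat -> 'I_n -> Om -> 'I_n.
Variable est : forall n : nat, {mfun n.-tuple X >-> R}.

Definition data_sigma (n : nat) : set (set Om) :=
  g_sigma_preimage (fun i : 'I_n => Obs i : Om -> X).

Definition bootstrap_events (n : nat) (k : 'I_n + nat * 'I_n) :
    set (set Om) :=
  match k with
  | inl i => preimage_set_system [set: Om] (Obs i) measurable
  | inr (b, j) => preimage_set_system [set: Om] (@idx n b j) [set: set 'I_n]
  end.

Definition pairs_bootstrap : Prop :=
  forall n : nat,
  [/\ forall b j k, measurable (@idx n b j @^-1` [set k]),
      forall b j k, P (@idx n b j @^-1` [set k]) = (n%:R^-1)%:E &
      mutually_independent P (@bootstrap_events n)].

Definition sample (n : nat) (w : Om) : n.-tuple X :=
  [tuple Obs i w | i < n].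

Definition resample (n b : nat) (w : Om) : n.-tuple X :=
  [tuple Obs (@idx n b j w) w | j < n].

Definition psi_hat (n : nat) (w : Om) : R := est n (sample n w).

Definition psi_boot (n b : nat) (w : Om) : R := est n (resample n b w).

Definition psi_boot_mean (n B : nat) (w : Om) : R :=
  B%:R^-1 * \sum_(b < B) psi_boot n b w.

Definition var_boot (n B : nat) (w : Om) : R :=
  (B%:R - 1)^-1 * \sum_(b < B) (psi_boot n b w - psi_boot_mean n B w) ^+ 2.

Definition T_stat (psi0 : R) (n : nat) (w : Om) : R :=
  Num.sqrt n%:R * (psi_hat n w - psi0).

Definition T_boot (n b : nat) (w : Om) : R :=
  Num.sqrt n%:R * (psi_boot n b w - psi_hat n w).

Definition D_bar (D : X -> R) (n : nat) (w : Om) : R :=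
  n%:R^-1 * \sum_(i < n) D (Obs i w).

End bootstrap.

(* Main.v *)
(* Both sides of the convergence tend to 0.  Since sup_n E[T_n^2] is finite, the
   sampling variance is O(1/n).  On the data event E_n where the conditional law
   of T_n^* has second moment at most C = 8 + 2 sup_n E[T_n^2], Markov's
   inequality applied to the average of T_b^2 / n over the resamples bounds the
   bootstrap variance in probability by O(1/n), uniformly in B >= 2: all
   resamples have the same conditional law given the data, because the draws are
   uniform and independent of the data.  A coupling of cost at most 2 gives
   x^2 <= 2 (x - y)^2 + 2 y^2 on average, so E_n contains the event where the
   Mallows distance is at most 1, whose probability tends to 1.

   The variance decomposition is the expansion of Var(bar D_n + R_rem), where
   Var(bar D_n) = sigma^2 / n because the centred D(O_i) are pairwise
   uncorrelated. *)
From HB Require Import structures.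
Require Import Defs.
From mathcomp Require Import all_boot all_order all_algebra.
From mathcomp Require Import all_classical all_reals all_analysis.
From mathcomp Require Import measurable_realfun ring lra.

Set Implicit Arguments.
Unset Strict Implicit.
Unset Printing Implicit Defensive.

Import Order.TTheory GRing.Theory Num.Theory.
Import numFieldNormedType.Exports.
Import HBNNSimple.

Local Open Scope classical_set_scope.
Local Open Scope ring_scope.

(** * Integration against a regular conditional law *)

Section conditional_law.
Local Open Scope ereal_scope.
Context (R : realType) (d : measure_display) (Om : measurableType d).
Variables (P : probability Om R) (G : set (set Om)) (Y : Om -> R).
Variable K : Om -> probability R R.
Hypothesis GM : G `<=` measurable.
Hypothesis mY : measurable_fun [set: Om] Y.
Hypothesis KY : is_cond_law P G Y K.

Let mK A : measurable A -> measurable_fun [set: Om] (fun w => K w A).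
Proof.
by move=> mA _ Z mZ; rewrite setTI; apply: GM; exact: (KY mA).1.
Qed.

(** A simple function is a finite combination of indicators of its level sets, and for an indicator
    the identity is the defining property of [K]. *)
Lemma integral_cond_law_nnsfun (s : {nnsfun R >-> R}) E : G E ->
  \int[P]_(w in E) (s (Y w))%:E = \int[P]_(w in E) \int[K w]_x (s x)%:E.
Proof.
move=> GE; have mE := GM GE.
transitivity (\int[P]_(w in E)
    (\sum_(y \in range s) (y * \1_(s @^-1` [set y]) (Y w))%:E)).
  apply: eq_integral => w _; rewrite fsumEFin//; congr EFin.
  exact: fimfunE.
rewrite ge0_integral_fsum//; last 2 first.
- move=> y; apply/measurable_EFinP; apply: measurable_funM => //.
  apply: measurable_funTS; apply: measurableT_comp => //.
- by move=> y w _; rewrite EFinM nnfun_muleindic_ge0.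
transitivity (\int[P]_(w in E)
    (\sum_(y \in range s) (y%:E * K w (s @^-1` [set y])))); last first.
  by apply: eq_integral => w _; rewrite integralT_nnsfun sintegralE.
rewrite ge0_integral_fsum//; last 2 first.
- move=> y; apply: emeasurable_funM => //.
  by apply: measurable_funTS; exact: mK.
- by move=> y w _; exact: nnsfun_mulemu_ge0.
apply: eq_fsbigr => y /[!inE] -[x _ sxy].
have y0 : (0 <= y)%R by rewrite -sxy.
rewrite ge0_integralZl//; last 1 first.
  by apply: measurable_funTS; exact: mK.
rewrite (@KY _ _).2//.
under eq_integral do rewrite EFinM.
rewrite ge0_integralZl//; last 1 first.
  apply/measurable_EFinP; apply: measurable_funTS; exact: measurableT_comp.
congr (_ * _).
rewrite (_ : (fun w => _) = (EFin \o \1_(Y @^-1` (s @^-1` [set y])))).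
  by rewrite integral_indic// 1?setIC// -[X in measurable X]setTI; exact: mY.
by apply/funext => w /=; rewrite !indicE.
Qed.

(** Simple approximations increase to [f]. On the right, monotone convergence applies twice: under
    each [K w], then over [E]. *)
Lemma integral_cond_law (f : R -> \bar R) E : measurable_fun [set: R] f ->
  (forall x, 0 <= f x) -> G E ->
  \int[P]_(w in E) f (Y w) = \int[P]_(w in E) \int[K w]_x f x.
Proof.
move=> mf f0 GE; have mE := GM GE.
pose s := nnsfun_approx measurableT mf.
have sE x : f x = limn (fun n => (s n x)%:E).
  apply/esym/cvg_lim => //; apply: cvg_nnsfun_approx => // *; exact: f0.
have nds x : {homo (fun n => (s n x)%:E) : m n / (m <= n)%N >-> m <= n}.
  by move=> m n mn; rewrite lee_fin; exact/lefP/nd_nnsfun_approx.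
have ms n : measurable_fun [set: R] (fun x => (s n x)%:E) by exact/measurable_EFinP.
transitivity (limn (fun n => \int[P]_(w in E) (s n (Y w))%:E)).
  under eq_integral do rewrite sE.
  apply: monotone_convergence => //.
  - by move=> n; apply: measurable_funTS; exact: measurableT_comp (ms n) mY.
  - by move=> n x _; rewrite lee_fin.
transitivity (limn (fun n => \int[P]_(w in E) \int[K w]_x (s n x)%:E)).
  by congr (limn _); apply/funext => n; exact: integral_cond_law_nnsfun.
rewrite -monotone_convergence//.
- apply: eq_integral => w _.
  rewrite -monotone_convergence//; first by apply: eq_integral => x _; rewrite sE.
  + by move=> n x _; rewrite lee_fin.
- move=> n; apply: measurable_funTS.
  apply: measurable_fun_integral_kernel => //.
  by move=> z; rewrite lee_fin.
- by move=> n w _; apply: integral_ge0 => x _; rewrite lee_fin.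
- move=> w _ m n mn; apply: ge0_le_integral => //.
  + by move=> x _; rewrite lee_fin.
  + by move=> x _; exact: nds.
Qed.

End conditional_law.

Lemma bigsetU_fintype (T : Type) (I : finType) (F : I -> set T) :
  \big[setU/set0]_i F i = \bigcup_i F i.
Proof.
rewrite -bigcup_seq; congr bigcup; apply/seteqP; split => // i _ /=.
exact: mem_index_enum.
Qed.

(** * Resamples are identically distributed given the data *)

Section exchangeability.
Context (R : realType) (d d' : measure_display).
Context (Om : measurableType d) (X : measurableType d').
Variables (P : probability Om R) (Obs : nat -> {RV P >-> X}).
Variable idx : forall n : nat, nat -> 'I_n -> Om -> 'I_n.
Variable est : forall n : nat, {mfun n.-tuple X >-> R}.
Hypothesis hboot : pairs_bootstrap Obs idx.
Variable n : nat.

Lemma data_sigma_measurable : data_sigma Obs n `<=` measurable.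
Proof.
apply: smallest_sub; first exact: sigma_algebra_measurable.
move=> A; rewrite bigsetU_fintype => -[i _ [B mB <-]].
rewrite setTI -[X in measurable X]setTI; exact: measurable_funP.
Qed.

(** The bootstrap statistic with its draws frozen to a fixed pattern [f]: what randomness remains
    comes from the data alone. *)
Definition T_boot_at (f : 'I_n -> 'I_n) (w : Om) : R :=
  Num.sqrt n%:R * (est n [tuple Obs (f j) w | j < n] - psi_hat Obs est n w).

Lemma T_boot_at_data f A : measurable A -> data_sigma Obs n (T_boot_at f @^-1` A).
Proof.
move=> mA.
(* [T0] is [Om] carrying only the data sigma-algebra, so measurability on [T0] is membership of
   preimages in [data_sigma]. *)
pose T0 := g_sigma_algebraType
  (\big[setU/set0]_(i < n) preimage_set_system setT (Obs i) measurable).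
have mO (i : 'I_n) : measurable_fun [set: T0] (Obs i : T0 -> X).
  move=> _ B mB; apply: sub_sigma_algebra.
  by rewrite bigsetU_fintype; exists i => //=; exists B.
have mest (g : 'I_n -> 'I_n) :
    measurable_fun [set: T0] (fun w => est n [tuple Obs (g j) w | j < n]).
  apply: measurableT_comp => //; apply/measurable_fun_tnthP => i.
  rewrite (_ : _ \o _ = Obs (g i)); first exact: mO.
  by apply/funext => w /=; rewrite tnth_mktuple.
have mf : measurable_fun [set: T0] (T_boot_at f).
  apply: measurable_funM => //; apply: measurable_funB => //.
  exact: (mest id).
by rewrite -[X in data_sigma _ _ X]setTI; exact: mf.
Qed.

Definition draws (b : nat) (f : {ffun 'I_n -> 'I_n}) : set Om :=
  \bigcap_(j in [set: 'I_n]) (@idx n b j @^-1` [set f j]).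

Lemma draws_measurable b f : measurable (draws b f).
Proof.
apply: fin_bigcap_measurable => // j _.
by have [+ _ _] := hboot n; exact.
Qed.

(** The finitely many events [draws b f] partition [Om], and on each of them the bootstrap statistic
    is [T_boot_at f]. *)
Lemma T_boot_preimage b A :
  T_boot Obs idx est n b @^-1` A =
  \bigcup_(f in [set: {ffun 'I_n -> 'I_n}]) (T_boot_at f @^-1` A `&` draws b f).
Proof.
have TE w f : draws b f w -> T_boot Obs idx est n b w = T_boot_at f w.
  move=> fw; rewrite /T_boot /T_boot_at /psi_boot; congr (_ * (est n _ - _)).
  by apply: eq_from_tnth => j; rewrite !tnth_mktuple (fw j I).
apply/seteqP; split=> [w Aw|w [f _ [/= Aw fw]]]; last by rewrite /= (TE _ _ fw).
have fw : draws b [ffun j => @idx n b j w] w by move=> j _ /=; rewrite ffunE.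
by exists [ffun j => @idx n b j w] => //; split => //=; rewrite -(TE _ _ fw).
Qed.

Lemma measurable_T_boot b : measurable_fun [set: Om] (T_boot Obs idx est n b).
Proof.
move=> _ A mA; rewrite setTI T_boot_preimage.
apply: fin_bigcup_measurable => // f _; apply: measurableI.
  by apply: data_sigma_measurable; exact: T_boot_at_data.
exact: draws_measurable.
Qed.

(** Each of the n^n patterns has probability n^-n independently of the data, whatever [b].
    Independence gives this on cylinders, and uniqueness of measures extends it to all data
    events. *)
Lemma probability_data_draws b f E : data_sigma Obs n E ->
  P (E `&` draws b f) = (P E * (n%:R^-1 ^+ n)%:E)%E.
Proof.
have [_ Pidx ind] := hboot n.
(* The cylinders form a pi-system generating the data sigma-algebra. *)
pose rect := [set E | exists2 B : 'I_n -> set X,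
  (forall i, measurable (B i)) & E = \bigcap_(i in [set: 'I_n]) (Obs i @^-1` B i)].
have mrect : rect `<=` measurable.
  move=> _ [B mB ->]; apply: fin_bigcap_measurable => // i _.
  by rewrite -[X in measurable X]setTI; exact: measurable_funP.
have rectT : rect setT.
  exists (fun=> setT) => //; apply/seteqP; split => // w _ i _; exact.
have rectI : setI_closed rect.
  move=> _ _ [B mB ->] [C mC ->]; exists (fun i => B i `&` C i).
    by move=> i; exact: measurableI.
  by rewrite -bigcapI; apply: eq_bigcapr => i _; rewrite preimage_setI.
have Prect (B : 'I_n -> set X) : (forall i, measurable (B i)) ->
    P (\bigcap_(i in [set: 'I_n]) (Obs i @^-1` B i)) =
      (\prod_(i < n) P (Obs i @^-1` B i))%E /\
    P (\bigcap_(i in [set: 'I_n]) (Obs i @^-1` B i) `&` draws b f) =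
      (\prod_(i < n) P (Obs i @^-1` B i) * (n%:R^-1 ^+ n)%:E)%E.
  move=> mB.
  pose A (k : 'I_n + nat * 'I_n) : set Om := match k with
    | inl i => Obs i @^-1` B i | inr (c, j) => @idx n c j @^-1` [set f j] end.
  have HA k : bootstrap_events Obs idx k (A k).
    by case: k => [i|[c j]] /=; [exists (B i)|exists [set f j]] => //; rewrite setTI.
  (* [J1] lists the observations and [J2] the draws of resample [b]. Independence along [J1], then
     along [J1 ++ J2], gives products differing by n factors 1/n. *)
  pose J1 : seq ('I_n + nat * 'I_n) := [seq inl i | i <- enum 'I_n].
  pose J2 : seq ('I_n + nat * 'I_n) := [seq inr (b, j) | j <- enum 'I_n].
  have U1 : uniq J1 by rewrite map_inj_uniq ?enum_uniq// => i j [].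
  have U2 : uniq (J1 ++ J2).
    rewrite cat_uniq U1 map_inj_uniq ?enum_uniq ?andbT//=; last by move=> i j [].
    by apply/hasPn => _ /mapP[j _ ->]; apply/negP => /mapP[].
  have C1 : \bigcap_(k in [set` J1]) A k = \bigcap_(i in [set: 'I_n]) (Obs i @^-1` B i).
    apply/seteqP; split=> [w Aw i _|w Bw _ /= /mapP[i _ ->]]; last exact: Bw.
    by apply: (Aw (inl i)) => /=; rewrite map_f// mem_enum.
  have C2 : \bigcap_(k in [set` J1 ++ J2]) A k =
      \bigcap_(i in [set: 'I_n]) (Obs i @^-1` B i) `&` draws b f.
    rewrite -C1; apply/seteqP; split=> [w Aw|w [Aw Bw] k].
      split=> [k kJ|j _]; first by apply: Aw; rewrite /= mem_cat kJ.
      by apply: (Aw (inr (b, j))) => /=; rewrite mem_cat (map_f _ (mem_enum _ _)) ?orbT.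
    rewrite /= mem_cat => /orP[kJ|/mapP[j _ ->]]; [exact: Aw|exact: Bw].
  rewrite -C2 -C1 !ind// big_cat/= !big_map -enumT !big_enum/=; split => //.
  congr (_ * _)%E; under eq_bigr do rewrite Pidx.
  by rewrite prodEFin prodr_const card_ord.
move=> dE.
have c0 : 0 <= n%:R^-1 ^+ n :> R by rewrite exprn_ge0.
have bigT : \bigcup_(k : nat) [set: Om] = setT by rewrite bigcup_const.
have rE : <<s rect >> E.
  apply: smallest_sub dE; first exact: smallest_sigma_algebra.
  move=> A; rewrite bigsetU_fintype => -[i _ [B mB <-]].
  (* An event about one observation is a cylinder whose other sides are the whole space. *)
  apply: sub_sigma_algebra; exists (fun j => if j == i then B else setT).
    by move=> j; case: ifP.
  rewrite setTI; apply/seteqP; split=> [w Bw j _ /=|w Aw].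
    by case: eqP => [->|].
  by have := Aw i I; rewrite /= eqxx.
(* Both sides of the claim are finite measures in [E]: [P] restricted to the draw event, and [P]
   scaled by n^-n. *)
suff : mrestr P (draws_measurable b f) E = mscale (NngNum c0) P E.
  by rewrite /mrestr /mscale /= muleC.
apply: (@g_sigma_algebra_measure_unique _ _ _ rect mrect (fun=> setT)) => //.
- move=> _ [B mB ->]; rewrite /= /mrestr /mscale/=.
  by rewrite (Prect _ mB).2 -(Prect _ mB).1 muleC.
- move=> _; rewrite /= /mrestr setTI (le_lt_trans (probability_le1 _ _)) ?ltry//.
  exact: draws_measurable.
Qed.

(** Summing over draw patterns expresses the joint probability with a data event by terms free of
    [b], so one kernel serves every resample. *)
Lemma is_cond_law_T_boot b (K : Om -> probability R R) :
  is_cond_law P (data_sigma Obs n) (T_boot Obs idx est n 0) K ->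
  is_cond_law P (data_sigma Obs n) (T_boot Obs idx est n b) K.
Proof.
move=> KT A mA; split; first exact: (KT A mA).1.
move=> E GE; rewrite (KT A mA).2//.
have PT c : P (E `&` T_boot Obs idx est n c @^-1` A) =
    (\sum_(f \in [set: {ffun 'I_n -> 'I_n}])
       (P (E `&` T_boot_at f @^-1` A) * (n%:R^-1 ^+ n)%:E))%E.
  rewrite T_boot_preimage setI_bigcupr measure_fin_bigcup; first last.
  - move=> f _; apply: measurableI; first exact: data_sigma_measurable.
    apply: measurableI; last exact: draws_measurable.
    by apply: data_sigma_measurable; exact: T_boot_at_data.
  - move=> f g _ _ [w [[_ [_ fw]] [_ [_ gw]]]]; apply/ffunP => j.
    by rewrite -(fw j I) -(gw j I).
  - exact: finite_finset.
  - apply: eq_fsbigr => f _; rewrite /= setIA probability_data_draws//.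
    apply: (@measurableI _ (g_sigma_algebraType
      (\big[setU/set0]_(i < n) preimage_set_system setT (Obs i) measurable))) => //.
    exact: T_boot_at_data.
by rewrite !PT.
Qed.

End exchangeability.

(** With m the mean, the two sides differ by B (m - c)^2, since deviations from m sum to zero. *)
Lemma sum_sqr_sub_mean_le (R : realFieldType) (B : nat) (x : 'I_B -> R) (c : R) :
  \sum_b (x b - B%:R^-1 * \sum_i x i) ^+ 2 <= \sum_b (x b - c) ^+ 2.
Proof.
have [B0|B0] := posnP B; first by subst B; rewrite !big_ord0.
set m := B%:R^-1 * _.
have Bm : \sum_b x b = B%:R * m by rewrite mulVKf// pnatr_eq0 -lt0n.
rewrite [leRHS](_ : _ = \sum_b (x b - m) ^+ 2 + B%:R * (m - c) ^+ 2).
  by rewrite lerDl mulr_ge0// sqr_ge0.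
have -> : B%:R * (m - c) ^+ 2 = \sum_(b < B) ((m - c) ^+ 2 + 2 * (x b - m) * (m - c)).
  rewrite big_split/= sumr_const card_ord -mulr_suml -mulr_sumr sumrB Bm.
  by rewrite sumr_const card_ord -(mulr_natl m) subrr mulr0 mul0r addr0 mulr_natl.
rewrite -big_split/=; apply: eq_bigr => b _; ring.
Qed.

(** * Second moments and the Mallows distance *)

Section L2.
Context (R : realType) (d : measure_display) (T : measurableType d).
Local Open Scope ereal_scope.

Lemma sqr_Lnorm2 (mu : {measure set T -> \bar R}) (f : T -> R) :
  'N[mu]_2%:E[(fun x => (f x)%:E)] `^ 2 = \int[mu]_x (f x ^+ 2)%:E.
Proof.
rewrite poweR_Lnorm//; apply: eq_integral => x _.
rewrite -[abse _]/((`|f x|%R)%:E) poweR_EFin powR_mulrn ?normr_ge0//.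
by rewrite real_normK// num_real.
Qed.

Lemma Lfun2P (mu : {measure set T -> \bar R}) (f : T -> R) :
  measurable_fun [set: T] f ->
  \int[mu]_x (f x ^+ 2)%:E < +oo -> f \in Lfun mu 2%:E.
Proof.
move=> mf; rewrite -sqr_Lnorm2 => foo.
rewrite inE; apply/andP; split; rewrite inE//=.
rewrite /finite_norm ltey; apply: contraTneq foo => ->.
by rewrite poweRE/= ?ltxx// pnatr_eq0.
Qed.

End L2.

Lemma mallows2_second_moment (R : realType)
    (mu nu : {measure set R -> \bar R}) : (mallows2 mu nu <= 1%:E)%E ->
  (\int[mu]_x (x ^+ 2)%:E <= 8%:E + 2%:E * \int[nu]_x (x ^+ 2)%:E)%E.
Proof.
(* Relaxing the bound 1 to a strict bound 2 yields an actual coupling without attaining the infimum;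
   its squared cost is at most 4, whence the constant 8 = 2 * 2^2. *)
move=> d1; have /ereal_inf_lt[_ [pi pic <-] dpi] : (mallows2 mu nu < 2%:E)%E.
  by rewrite (le_lt_trans d1)// lte_fin ltr1n.
have msq : measurable_fun [set: R] (fun x : R => (x ^+ 2)%:E).
  by apply/measurable_EFinP; exact: measurable_funX.
have mpi (g : R * R -> R) : measurable_fun [set: R * R] g ->
    measurable_fun [set: R * R] (fun z => (g z ^+ 2)%:E).
  by move=> mg; apply/measurable_EFinP; exact: measurable_funX.
have m1 := mpi _ measurable_fst; have m2 := mpi _ measurable_snd.
have m12 := mpi _ (measurable_funB measurable_fst measurable_snd).
have -> : (\int[mu]_x (x ^+ 2)%:E = \int[pi]_z (z.1 ^+ 2)%:E)%E.
  rewrite -(@ge0_integral_pushforward _ _ _ _ _ _ measurable_fst pi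
    setT (fun x => (x ^+ 2)%:E)%E)//.
    by apply: eq_measure_integral => A mA _; rewrite -(pic _ mA).1.
  by move=> x _; rewrite lee_fin sqr_ge0.
have -> : (\int[nu]_x (x ^+ 2)%:E = \int[pi]_z (z.2 ^+ 2)%:E)%E.
  rewrite -(@ge0_integral_pushforward _ _ _ _ _ _ measurable_snd pi
    setT (fun x => (x ^+ 2)%:E)%E)//.
    by apply: eq_measure_integral => A mA _; rewrite -(pic _ mA).2.
  by move=> x _; rewrite lee_fin sqr_ge0.
(* x^2 <= 2 (x - y)^2 + 2 y^2, as the difference is (x - 2 y)^2 *)
apply: (@le_trans _ _ (\int[pi]_z
    (2%:E * ((z.1 - z.2) ^+ 2)%:E + 2%:E * (z.2 ^+ 2)%:E))%E).
  apply: ge0_le_integral => //.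
  - by move=> x _; rewrite lee_fin sqr_ge0.
  - by apply: emeasurable_funD; exact: measurable_funeM.
  - move=> z _; rewrite -!EFinM -EFinD lee_fin -subr_ge0.
    rewrite [leRHS](_ : _ = (z.1 - 2 * z.2) ^+ 2) ?sqr_ge0//; ring.
rewrite ge0_integralD//; last 4 first.
- by move=> z _; rewrite -EFinM lee_fin mulr_ge0// sqr_ge0.
- exact: measurable_funeM.
- by move=> z _; rewrite -EFinM lee_fin mulr_ge0// sqr_ge0.
- exact: measurable_funeM.
rewrite !ge0_integralZl//; try by move=> z _; rewrite lee_fin sqr_ge0.
rewrite leeD2r//.
have -> : 8 = 2 * 2 ^+ 2 :> R by ring.
rewrite EFinM lee_wpmul2l ?lee_fin//.
rewrite -sqr_Lnorm2.
rewrite -[(2 ^+ 2)%R]powR_mulrn// -poweR_EFin.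
apply: gt0_ler_poweR; rewrite ?lee_fin// ?in_itv/= ?leey ?Lnorm_ge0 ?andbT//.
exact: ltW.
Qed.

(** * A Markov bound for the bootstrap variance *)

Section resampling_variance.
Context (R : realType) (d d' : measure_display).
Context (Om : measurableType d) (X : measurableType d').
Variables (P : probability Om R) (Obs : nat -> {RV P >-> X}).
Variable idx : forall n : nat, nat -> 'I_n -> Om -> 'I_n.
Variable est : forall n : nat, {mfun n.-tuple X >-> R}.
Hypothesis hboot : pairs_bootstrap Obs idx.

Lemma var_boot_ge0 n B w : (1 < B)%N -> 0 <= var_boot Obs idx est n B w.
Proof.
move=> B1; rewrite mulr_ge0 ?sumr_ge0// => [|b _]; last exact: sqr_ge0.
by rewrite invr_ge0 subr_ge0 ler1n ltnW.
Qed.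

(** Centring at [psi_hat] instead of the resample mean only increases the sum of squares, and 1/(B -
    1) <= 2/B once B >= 2. *)
Lemma var_boot_le n B w : (0 < n)%N -> (1 < B)%N ->
  var_boot Obs idx est n B w <=
  2 / (B%:R * n%:R) * \sum_(b < B) T_boot Obs idx est n b w ^+ 2.
Proof.
move=> n0 B1; have n0R : 0 < n%:R :> R by rewrite ltr0n.
have B1R : 2 <= B%:R :> R by rewrite (ler_nat _ 2).
have -> : \sum_(b < B) T_boot Obs idx est n b w ^+ 2 =
    n%:R * \sum_(b < B) (psi_boot Obs idx est n b w - psi_hat Obs est n w) ^+ 2.
  by rewrite mulr_sumr; apply: eq_bigr => b _; rewrite exprMn sqr_sqrtr// ltW.
rewrite mulrA; set S := \sum_(b < B) _.
have -> : 2 / (B%:R * n%:R) * n%:R = 2 / B%:R :> R by field; lra.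
apply: (@le_trans _ _ ((B%:R - 1)^-1 * S)).
  apply: ler_wpM2l; last exact: sum_sqr_sub_mean_le.
  by rewrite invr_ge0; lra.
apply: ler_wpM2r; first by apply: sumr_ge0 => b _; exact: sqr_ge0.
rewrite -subr_ge0 (_ : _ - _ = (B%:R - 2) / (B%:R * (B%:R - 1))).
  by rewrite mulr_ge0 ?invr_ge0 ?mulr_ge0; lra.
by field; apply/andP; split; lra.
Qed.

(** On [E] each resample has conditional second moment at most [C], so the average over [B] of them
    integrates to at most [C]. This makes the bound free of [B]. *)
Lemma boot_markov n B (K : Om -> probability R R) (E : set Om) (C e : R) :
  is_cond_law P (data_sigma Obs n) (T_boot Obs idx est n 0) K ->
  (0 < n)%N -> (0 < B)%N -> 0 < e -> 0 <= C ->
  data_sigma Obs n E ->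
  (forall w, E w -> (\int[K w]_x (x ^+ 2)%:E <= C%:E)%E) ->
  (P (E `&` [set w | (e <= 2 / (B%:R * n%:R) *
      \sum_(b < B) T_boot Obs idx est n b w ^+ 2)%R])
    <= (2 * C / (n%:R * e))%:E)%E.
Proof.
move=> KT n0 B0 e0 C0 GE EC; have mE : measurable E by exact: data_sigma_measurable GE.
have n0R : 0 < n%:R :> R by rewrite ltr0n.
have B0R : 0 < B%:R :> R by rewrite ltr0n.
have mT b : measurable_fun [set: Om] (fun w => T_boot Obs idx est n b w ^+ 2).
  by apply: measurable_funX; exact: measurable_T_boot.
have mTE b : measurable_fun [set: Om] (fun w => (T_boot Obs idx est n b w ^+ 2)%:E).
  exact/measurable_EFinP.
have c0 : 0 <= 2 / (B%:R * n%:R) :> R by rewrite divr_ge0// mulr_ge0// ltW.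
set q := fun w => 2 / (B%:R * n%:R) * \sum_(b < B) T_boot Obs idx est n b w ^+ 2.
have q0 w : 0 <= q w.
  by rewrite mulr_ge0// sumr_ge0// => b _; exact: sqr_ge0.
have mq : measurable_fun [set: Om] (EFin \o q).
  apply/measurable_EFinP; apply: measurable_funM => //.
  exact: measurable_sum.
have Eq : (\int[P]_(w in E) (q w)%:E <= (2 * C / n%:R)%:E)%E.
  under eq_integral do rewrite EFinM -sumEFin.
  rewrite ge0_integralZl//; last 2 first.
  - by apply: measurable_funTS; exact: emeasurable_sum.
  - by move=> w _; apply: sume_ge0 => b _; rewrite lee_fin sqr_ge0.
  rewrite ge0_integral_sum//; last 2 first.
  - by move=> b; exact: measurable_funTS.
  - by move=> b w _; rewrite lee_fin sqr_ge0.
  have -> : 2 * C / n%:R = 2 / (B%:R * n%:R) * \sum_(b < B) C :> R.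
    by rewrite sumr_const card_ord -(mulr_natl C); field; rewrite !gt_eqF.
  rewrite [leRHS]EFinM; apply: lee_wpmul2l; first by rewrite lee_fin.
  rewrite -sumEFin; apply: lee_sum => b _.
  have mx : measurable_fun [set: R] (fun x : R => (x ^+ 2)%:E).
    by apply/measurable_EFinP; exact: measurable_funX.
  have x0 (x : R) : (0 <= (x ^+ 2)%:E)%E by rewrite lee_fin sqr_ge0.
  rewrite (integral_cond_law (@data_sigma_measurable _ _ _ _ _ _ _ _)
    (measurable_T_boot est hboot n b) (is_cond_law_T_boot hboot b KT) mx x0 GE).
  apply: (@le_trans _ _ (\int[P]_(w in E) C%:E)%E).
    apply: ge0_le_integral => //.
    - by move=> w _; exact: integral_ge0.
    - apply: measurable_funTS; apply: measurable_fun_integral_kernel => //.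
      move=> U mU _ Z mZ; rewrite setTI; apply: data_sigma_measurable.
      exact: (KT _ mU).1.
  by rewrite integral_cst// -[leRHS]mule1; apply: lee_wpmul2l; rewrite ?lee_fin ?probability_le1.
have -> : 2 * C / (n%:R * e) = (2 * C / n%:R) / e by field; rewrite !gt_eqF.
rewrite EFinM lee_pdivlMr// (le_trans _ Eq)// muleC.
have qE : (\int[P]_(w in E) (q w)%:E = \int[P]_(w in E) `|(EFin \o q) w|)%E.
  by apply: eq_integral => w _; rewrite /= ger0_norm.
rewrite qE; apply: le_trans (le_integral_abse P mE (measurable_funTS mq) e0).
rewrite (_ : [set w | (e%:E <= _)%E] = [set w | e <= q w])//.
by apply/seteqP; split => w /=; rewrite lee_fin ger0_norm.
Qed.

End resampling_variance.

Lemma cvg_divn (R : realType) (c : R) : c / n%:R @[n --> \oo] --> 0.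
Proof.
apply/cvgr0Pnorm_lt => e e0; near=> n.
have nc : `|c| / e < n%:R by near: n; exact: nbhs_infty_gtr.
have n0 : 0 < n%:R :> R by rewrite (le_lt_trans _ nc)// divr_ge0// ltW.
rewrite normrM normfV (gtr0_norm n0) ltr_pdivrMr// mulrC -ltr_pdivrMr//.
Unshelve. all: by end_near. Qed.

(** * Consistency of the bootstrap variance *)

Section consistency.
Context (R : realType) (d d' : measure_display).
Context (Om : measurableType d) (X : measurableType d').
Variables (P : probability Om R) (Obs : nat -> {RV P >-> X}).
Variable est : forall n : nat, {mfun n.-tuple X >-> R}.

Lemma measurable_psi_hat n : measurable_fun [set: Om] (psi_hat Obs est n).
Proof.
apply: measurableT_comp => //; apply/measurable_fun_tnthP => i.
rewrite (_ : _ \o _ = Obs i)//; apply/funext => w /=.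
by rewrite tnth_mktuple.
Qed.

Lemma measurable_T_stat psi0 n : measurable_fun [set: Om] (T_stat Obs est psi0 n).
Proof.
apply: measurable_funM => //; apply: measurable_funB => //.
exact: measurable_psi_hat.
Qed.

Lemma expectation_T_stat_sqr psi0 n :
  ('E_P[fun w => (T_stat Obs est psi0 n w ^+ 2)%R]
   = n%:R%:E * 'E_P[fun w => ((psi_hat Obs est n w - psi0) ^+ 2)%R])%E.
Proof.
rewrite unlock -ge0_integralZl//.
- by apply: eq_integral => w _; rewrite -EFinM exprMn sqr_sqrtr.
- apply/measurable_EFinP; apply: measurable_funX; apply: measurable_funB => //.
  exact: measurable_psi_hat.
- by move=> w _; rewrite lee_fin sqr_ge0.
Qed.

Lemma psi_hat_Lfun2 psi0 (s : R) n : (0 < n)%N ->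
  ('E_P[fun w => (T_stat Obs est psi0 n w ^+ 2)%R] <= s%:E)%E ->
  (fun w => psi_hat Obs est n w - psi0) \in Lfun P 2%:E /\
  ('V_P[fun w => (psi_hat Obs est n w - psi0)%R] <= (s / n%:R)%:E)%E.
Proof.
move=> n0; rewrite expectation_T_stat_sqr muleC => Ts.
have n0R : 0 < n%:R :> R by rewrite ltr0n.
have {}Ts : ('E_P[fun w => ((psi_hat Obs est n w - psi0) ^+ 2)%R] <= (s / n%:R)%:E)%E.
  by rewrite EFinM lee_pdivlMr.
have X2 : (fun w => psi_hat Obs est n w - psi0) \in Lfun P 2%:E.
  apply: Lfun2P; first by apply: measurable_funB => //; exact: measurable_psi_hat.
  by move: Ts; rewrite unlock => /le_lt_trans; apply; exact: ltry.
split => //; rewrite varianceE//; apply: le_trans Ts.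
by rewrite -[leRHS]adde0; apply: leeD2l; rewrite oppe_le0 sqre_ge0.
Qed.

Variable idx : forall n : nat, nat -> 'I_n -> Om -> 'I_n.
Hypothesis hboot : pairs_bootstrap Obs idx.

Lemma var_boot_consistent (K : nat -> Om -> probability R R) (psi0 s : R)
    (B : nat -> nat) :
  (forall n, ('E_P[fun w => (T_stat Obs est psi0 n w ^+ 2)%R] <= s%:E)%E) ->
  (forall n, (0 < n)%N ->
     is_cond_law P (data_sigma Obs n) (T_boot Obs idx est n 0) (K n)) ->
  cvg_proba0 P (fun n w =>
     mallows2 (K n w) (pushforward P (T_stat Obs est psi0 n))) ->
  B n @[n --> \oo] --> \oo ->
  cvg_proba0 P (fun n w =>
       ((var_boot Obs idx est n (B n) w)%:E
        - 'V_P[fun w' => (psi_hat Obs est n w' - psi0)%R])%E).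
Proof.
move=> Ts KT d2 Boo e e0.
have s0 : 0 <= s.
  rewrite -lee_fin (le_trans _ (Ts 0))//; apply: expectation_ge0 => w.
  exact: sqr_ge0.
(* The bound of [mallows2_second_moment] when the second law is that of T_n, whose second moment is
   at most [s]. *)
pose C := 8 + 2 * s; have C0 : 0 <= C by rewrite addr_ge0// mulr_ge0.
pose E n := [set w | (\int[K n w]_x (x ^+ 2)%:E <= C%:E)%E].
have mx : measurable_fun [set: R] (fun x : R => (x ^+ 2)%:E).
  by apply/measurable_EFinP; exact: measurable_funX.
(* [boot_markov] requires a data event; the kernel [K n] is measurable for the data sigma-algebra,
   hence so is its second moment. *)
have GE n : (0 < n)%N -> data_sigma Obs n (E n).
  move=> n0.
  pose T0 := g_sigma_algebraType
    (\big[setU/set0]_(i < n) preimage_set_system setT (Obs i) measurable).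
  have mI : measurable_fun [set: T0] (fun w : T0 => \int[K n w]_x (x ^+ 2)%:E)%E.
    apply: (@measurable_fun_integral_kernel _ _ T0) => //.
      by move=> U mU _ Z mZ; rewrite setTI; exact: (KT n n0 U mU).1.
    by move=> x; rewrite lee_fin sqr_ge0.
  have := mI measurableT _ (emeasurable_itv `]-oo, C%:E]).
  by rewrite setTI.
have Ed n : (0 < n)%N -> ~` E n `<=`
    [set w | (1%:E < `|mallows2 (K n w) (pushforward P (T_stat Obs est psi0 n))|)%E].
  move=> n0 w; apply: contra_notP => /negP; rewrite -leNgt => dw.
  pose T : {mfun Om >-> R} := HB.pack (T_stat Obs est psi0 n)
    (isMeasurableFun.Build _ _ _ _ _ (measurable_T_stat psi0 n)).
  have := @mallows2_second_moment _ (K n w) (distribution P T).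
  move=> /(_ (le_trans (lee_abs _) dw)) /le_trans; apply.
  rewrite ge0_integral_distribution//; last by move=> x; rewrite lee_fin sqr_ge0.
  rewrite /C (EFinD 8) (EFinM 2 s); apply: leeD2l; apply: lee_wpmul2l => //.
  by have := Ts n; rewrite unlock.
have n0 : \forall n \near \oo, (0 < n)%N by exact: nbhs_infty_gt.
have B2 : \forall n \near \oo, (1 < B n)%N.
  exact: (Boo [set k | (1 < k)%N] (nbhs_infty_gt 1)).
(* The tolerance is split: the sampling variance eventually stays below e/2, leaving e/2 for the
   bootstrap variance. *)
have se : \forall n \near \oo, s / n%:R < e / 2.
  by apply: (cvgr_lt _ (cvg_divn s)); rewrite divr_gt0.
apply: (@squeeze_cvge _ _ _ _ (cst 0%E) _
  (fun n => mu_ext P [set w | (1%:E <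
       `|mallows2 (K n w) (pushforward P (T_stat Obs est psi0 n))|)%E] + (2 * C / (n%:R * (e / 2)))%:E)%E); first last.
- rewrite -(adde0 0%E); apply: cvgeD => //; first exact: d2.
  have -> : (fun n => (2 * C / (n%:R * (e / 2)))%:E) =
      (fun n => (2 * C / (e / 2) / n%:R)%:E).
    by apply/funext => n; congr EFin; rewrite invfM mulrA mulrAC.
  by apply: cvg_EFin; [exact: nearW|exact: cvg_divn].
- exact: cvg_cst.
near=> n.
have n1 : (0 < n)%N by near: n.
have b2 : (1 < B n)%N by near: n.
rewrite mu_ext_ge0//=.
set F := [set w | (e / 2 <= 2 / ((B n)%:R * n%:R) *
      \sum_(b < B n) T_boot Obs idx est n b w ^+ 2)%R].
have mE : measurable (E n) by apply: data_sigma_measurable (GE _ n1).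
have mF : measurable F.
  rewrite -[F]setTI; apply: measurable_fun_ler => //.
  apply: measurable_funM => //; apply: measurable_sum => b.
  by apply: measurable_funX; exact: measurable_T_boot.
(* As both variances are nonnegative and the sampling one is below e/2, a gap above [e] forces the
   bootstrap variance above e/2. *)
have sub : [set w | (e%:E < `|(var_boot Obs idx est n (B n) w)%:E
        - 'V_P[fun w' => (psi_hat Obs est n w' - psi0)%R]|)%E] `<=` ~` E n `|` (E n `&` F).
  move=> w /= ew; have [Ew|Ew] := pselect (E n w); [right; split => //|by left].
  have [X2 Vs] := psi_hat_Lfun2 n1 (Ts n).
  have V0 := variance_ge0 P (fun w' => (psi_hat Obs est n w' - psi0)%R).
  move: ew V0 Vs; rewrite -(fineK (variance_fin_num X2)).
  rewrite -EFinB lte_fin !lee_fin => ew V0 Vs.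
  rewrite /F /=; apply: le_trans (@var_boot_le _ _ _ _ _ _ Obs idx est n _ w n1 b2).
  have v0 := @var_boot_ge0 _ _ _ _ _ _ Obs idx est n _ w b2.
  have sn : s / n%:R < e / 2 by near: n.
  have : fine ('V_P[fun w' => (psi_hat Obs est n w' - psi0)%R])%E < e / 2.
    exact: le_lt_trans sn.
  by move: ew; rewrite ltr_normr => /orP[]; lra.
apply: (le_trans (le_mu_ext P sub)).
rewrite measurable_mu_extE; last first.
  by apply: measurableU; [exact: measurableC|exact: measurableI].
have PU : (P (~` E n `|` (E n `&` F)) <= P (~` E n) + P (E n `&` F))%E.
  by apply: measureU2; [exact: measurableC|exact: measurableI].
apply: (le_trans PU); apply: leeD.
  (* The Mallows event containing the complement of [E n] is not known to be measurable, so the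
     comparison goes through the outer measure. *)
  rewrite -(measurable_mu_extE P (measurableC mE)).
  by apply: le_mu_ext; exact: Ed.
by apply: (boot_markov hboot (KT n n1)) => //; [exact: ltnW|exact: divr_gt0|exact: GE].
Unshelve. all: by end_near. Qed.

End consistency.

(** * Moments under almost sure equality, and variances of uncorrelated sums *)

Section variance_lemmas.
Context (R : realType) (d : measure_display) (T : measurableType d).
Variable P : probability T R.
Local Open Scope ereal_scope.

Lemma Lfun_measurable p (f : T -> R) : f \in Lfun P p -> measurable_fun [set: T] f.
Proof. by move=> /sub_Lfun_mfun; rewrite inE. Qed.

Let setT_fin : P [set: T] \is a fin_num := fin_num_measure P _ measurableT.

Lemma eq_expectation_ae (f g : T -> R) :
  measurable_fun [set: T] f -> measurable_fun [set: T] g ->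
  {ae P, forall w, f w = g w} -> 'E_P[f] = 'E_P[g].
Proof.
move=> mf mg fg; rewrite unlock; apply: ae_eq_integral => //.
- exact/measurable_EFinP.
- exact/measurable_EFinP.
- by apply: filterS fg => w /= -> _.
Qed.

Lemma eq_variance_ae (f g : T -> R) :
  measurable_fun [set: T] f -> measurable_fun [set: T] g ->
  {ae P, forall w, f w = g w} -> 'V_P[f] = 'V_P[g].
Proof.
move=> mf mg fg; rewrite /variance !covariance.unlock (eq_expectation_ae mf mg fg).
apply: eq_expectation_ae.
- by apply: measurable_funM; apply: measurable_funB.
- by apply: measurable_funM; apply: measurable_funB.
- by apply: filterS fg => w fgw; rewrite !fctE /= fgw.
Qed.

Lemma eq_Lfun2_ae (f g : T -> R) : measurable_fun [set: T] f ->
  {ae P, forall w, f w = g w} -> g \in Lfun P 2%:E -> f \in Lfun P 2%:E.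
Proof.
move=> mf fg g2; apply: Lfun2P => //.
have := Lfun2_integrable_sqr g2 => /integrableP[_].
suff -> : \int[P]_x `|(EFin \o (fun x => (g x ^+ 2)%R)) x| =
    \int[P]_x (f x ^+ 2)%:E by [].
apply/esym.
apply: ae_eq_integral => //.
- by apply/measurable_EFinP; exact: measurable_funX.
- apply/measurableT_comp => //; apply/measurable_EFinP; apply: measurable_funX.
  exact: Lfun_measurable g2.
- by apply: filterS fg => w /= -> _; rewrite ger0_norm// sqr_ge0.
Qed.

Lemma Lfun_sum p (p1 : 1 <= p) (Y : nat -> T -> R) k : (forall i, Y i \in Lfun P p) ->
  (fun w => \sum_(i < k) Y i w)%R \in Lfun P p.
Proof.
move=> Yp; rewrite (_ : (fun w => _) = (\sum_(i < k) Y i)%R).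
  by rewrite rpred_sum.
by apply/funext => w; rewrite fct_sumE.
Qed.

Lemma covariance_sum_eq0 (Y : nat -> T -> R) (Z : T -> R) k :
  (forall i, Y i \in Lfun P 2%:E) -> Z \in Lfun P 2%:E ->
  (forall i, (i < k)%N -> covariance P (Y i) Z = 0) ->
  covariance P (fun w => \sum_(i < k) Y i w)%R Z = 0.
Proof.
move=> Y2 Z2; elim: k => [|k IH] YZ.
  rewrite (_ : (fun w => _) = cst 0%R) ?covariance_cst_l//.
  by apply/funext => w; rewrite big_ord0.
rewrite (_ : (fun w => _) = ((fun w => \sum_(i < k) Y i w) \+ Y k)%R); last first.
  by apply/funext => w; rewrite big_ord_recr.
have S2 : (fun w => \sum_(i < k) Y i w)%R \in Lfun P 2%:E.
  by apply: Lfun_sum => //; rewrite lee1n.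
rewrite covarianceDl ?Lfun2_mul_Lfun1 ?(Lfun_subset12 setT_fin)//.
rewrite IH => [|i ik]; last by rewrite YZ// ltnW.
by rewrite YZ// adde0.
Qed.

Lemma variance_sum_uncorrelated (Y : nat -> T -> R) k :
  (forall i, Y i \in Lfun P 2%:E) ->
  (forall i j, (i < j)%N -> covariance P (Y i) (Y j) = 0) ->
  'V_P[(fun w => \sum_(i < k) Y i w)%R] = \sum_(i < k) 'V_P[Y i].
Proof.
move=> Y2 Yij; elim: k => [|k IH].
  rewrite big_ord0 (_ : (fun w => _) = cst 0%R) ?variance_cst//.
  by apply/funext => w; rewrite big_ord0.
rewrite (_ : (fun w => _) = ((fun w => \sum_(i < k) Y i w) \+ Y k)%R); last first.
  by apply/funext => w; rewrite big_ord_recr.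
rewrite varianceD//; last by apply: Lfun_sum => //; rewrite lee1n.
rewrite covariance_sum_eq0//; last by move=> i ik; exact: Yij.
by rewrite mule0 adde0 IH big_ord_recr.
Qed.

End variance_lemmas.

(** * The variance of the empirical mean of an i.i.d. sample *)

Section sampling.
Context (R : realType) (d d' : measure_display).
Context (Om : measurableType d) (X : measurableType d').
Variables (P : probability Om R) (P0 : probability X R) (Obs : nat -> {RV P >-> X}).
Hypothesis hiid : iid P0 Obs.
Local Open Scope ereal_scope.

Lemma integral_iid (f : X -> \bar R) i : measurable_fun [set: X] f ->
  (forall x, 0 <= f x) -> \int[P]_w f (Obs i w) = \int[P0]_x f x.
Proof.
move=> mf f0; rewrite -ge0_integral_distribution//.
by apply: eq_measure_integral => A mA _; exact: hiid.1.
Qed.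

(** A product measure is determined by its values on rectangles, where independence of the two
    observations gives the product. *)
Lemma iid_pair_law i j A : i != j -> measurable A ->
  (P0 \x P0) A = P ((fun w => (Obs i w, Obs j w)) @^-1` A).
Proof.
move=> ij mA.
have mO : measurable_fun [set: Om] (fun w => (Obs i w, Obs j w)).
  exact: measurable_fun_pair.
pose O : {mfun Om >-> (X * X)%type} := HB.pack (fun w => (Obs i w, Obs j w))
  (isMeasurableFun.Build _ _ _ _ _ mO).
rewrite -[RHS]/(distribution P O A).
apply: (@product_measure_unique _ _ _ _ _ P0 P0 (distribution P O)) => // B C mB mC.
pose F k := Obs k @^-1` (if k == i then B else C).
have := @hiid.2 [:: i; j] F; rewrite /= inE ij => /(_ isT).
have -> : \bigcap_(k in [set` [:: i; j]]) F k = O @^-1` (B `*` C).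
  rewrite /F; apply/seteqP; split => w /=.
    move=> Fw; split.
      by have := Fw i; rewrite /= !inE eqxx; exact.
    by have := Fw j; rewrite /= !inE eqxx orbT eq_sym (negbTE ij); exact.
  move=> [Bw Cw] k /=; rewrite !inE => /orP[] /eqP -> /=; first by rewrite eqxx.
  by rewrite eq_sym (negbTE ij).
rewrite /distribution /pushforward => ->.
  rewrite !big_cons big_nil mule1 /F eqxx eq_sym (negbTE ij).
  by rewrite -(hiid.1 i _ mB) -(hiid.1 j _ mC).
move=> k _; exists (if k == i then B else C); first by case: ifP.
by rewrite setTI.
Qed.

Variable D : X -> R.
Hypothesis hD0 : L20 P0 D.

Let mD : measurable_fun [set: X] D := Lfun_measurable hD0.1.

Lemma Lfun2_obs i : (D \o Obs i) \in Lfun P 2%:E.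
Proof.
apply: Lfun2P; first exact: measurableT_comp.
have /integrableP[_] := Lfun2_integrable_sqr hD0.1.
rewrite (@integral_iid (fun x => (D x ^+ 2)%:E))//.
- by congr (_ < _); apply: eq_integral => x _; rewrite /= ger0_norm ?sqr_ge0.
- by apply/measurable_EFinP; exact: measurable_funX.
- by move=> x; rewrite lee_fin sqr_ge0.
Qed.

Lemma expectation_obs i : 'E_P[D \o Obs i] = 0.
Proof.
rewrite -hD0.2 unlock.
have <- : \int[distribution P (Obs i)]_x (D x)%:E = \int[P0]_x (D x)%:E.
  by apply: eq_measure_integral => A mA _; exact: hiid.1.
rewrite integral_distribution//; first exact/measurable_EFinP.
apply/Lfun1_integrable; apply: Lfun_subset12 (Lfun2_obs i).
exact: fin_num_measure.
Qed.

Lemma variance_obs i : 'V_P[D \o Obs i] = 'E_P0[fun x => (D x ^+ 2)%R].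
Proof.
rewrite varianceE ?Lfun2_obs// expectation_obs.
rewrite expe2 mule0 sube0 unlock -(@integral_iid (fun x => (D x ^+ 2)%:E) i)//.
- by apply/measurable_EFinP; exact: measurable_funX.
- by move=> x; rewrite lee_fin sqr_ge0.
Qed.

(** The mixed moment is an integral under the product law; by Fubini its inner integral is a
    multiple of the mean of [D], which is zero. *)
Lemma covariance_obs i j : i != j -> covariance P (D \o Obs i) (D \o Obs j) = 0.
Proof.
move=> ij.
have fin := fin_num_measure P _ measurableT.
have fin0 := fin_num_measure P0 _ measurableT.
rewrite covarianceE ?Lfun2_mul_Lfun1 ?(Lfun_subset12 fin) ?Lfun2_obs//.
rewrite !expectation_obs mule0 sube0 unlock.
have mO : measurable_fun [set: Om] (fun w => (Obs i w, Obs j w)).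
  exact: measurable_fun_pair.
pose O : {mfun Om >-> (X * X)%type} := HB.pack (fun w => (Obs i w, Obs j w))
  (isMeasurableFun.Build _ _ _ _ _ mO).
pose h (z : X * X) := (D z.1 * D z.2)%:E.
have mh : measurable_fun [set: X * X] h.
  apply/measurable_EFinP; apply: measurable_funM.
    by apply: measurableT_comp => //; exact: measurable_fst.
  by apply: measurableT_comp => //; exact: measurable_snd.
have ih : P.-integrable [set: Om] (h \o O).
  have /Lfun1_integrable := Lfun2_mul_Lfun1 (Lfun2_obs i) (Lfun2_obs j).
  by [].
have law g : \int[P0 \x P0]_z g z = \int[distribution P O]_z g z.
  by apply: eq_measure_integral => A mA _; exact: iid_pair_law.
(* The integrability that Fubini requires is transported from [P], where a product of two L^2
   functions is integrable. *)
have ih0 : (P0 \x P0).-integrable [set: X * X] h.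
  apply/integrableP; split => //; rewrite law ge0_integral_distribution//.
    by have /integrableP[] := ih.
  exact: measurableT_comp.
transitivity (\int[distribution P O]_z h z); first by rewrite integral_distribution.
rewrite -law -integral12_prod_meas1//.
rewrite integral0_eq// => x _; rewrite /fubini_F /h /=.
under eq_integral do rewrite EFinM.
rewrite integralZl//; last by apply/Lfun1_integrable; exact: Lfun_subset12 hD0.1.
by have := hD0.2; rewrite unlock => ->; rewrite mule0.
Qed.

Lemma D_barE n : D_bar Obs D n = (n%:R^-1 \o* (fun w => \sum_(i < n) D (Obs i w)))%R.
Proof. by apply/funext => w; rewrite /D_bar /= mulrC. Qed.

Lemma Lfun2_D_bar n : D_bar Obs D n \in Lfun P 2%:E.
Proof.
rewrite D_barE Lfun_scale ?ler1n//.
by apply: (Lfun_sum _ _ Lfun2_obs); rewrite lee1n.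
Qed.

Lemma variance_D_bar n : (0 < n)%N ->
  'V_P[D_bar Obs D n] = 'E_P0[fun x => (D x ^+ 2)%R] * (n%:R^-1)%:E.
Proof.
move=> n0; rewrite D_barE varianceZ; last first.
  by apply: (Lfun_sum _ _ Lfun2_obs); rewrite lee1n.
rewrite (variance_sum_uncorrelated _ Lfun2_obs); last first.
  by move=> i j ij; apply: covariance_obs; rewrite ltn_eqF.
under eq_bigr do rewrite variance_obs.
(* Writing sigma^2 as the variance of one observation shows it finite, so n sigma^2 / n^2 simplifies
   over the reals. *)
rewrite -(variance_obs 0) -(fineK (variance_fin_num (Lfun2_obs 0))).
rewrite sumEFin sumr_const card_ord -EFinM -EFinM; congr EFin.
rewrite -(mulr_natl _ n); field.
by rewrite pnatr_eq0 -lt0n.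
Qed.

End sampling.

Unset Implicit Arguments.
Set Strict Implicit.

Theorem theorem5p2
  (R : realType) (d d' : measure_display)
  (Om : measurableType d) (X : measurableType d')
  (P : probability Om R)
  (Mod : set (probability X R)) (Psi : probability X R -> R)
  (P0 : probability X R) (D : X -> R)
  (Obs : nat -> {RV P >-> X})
  (est : forall n : nat, {mfun n.-tuple X >-> R})
  (Rrem xi : nat -> {RV P >-> R}) (r : nat -> R) (M : R)
  (idx : forall n : nat, nat -> 'I_n -> Om -> 'I_n)
  (Tboot_law : nat -> Om -> probability R R)
  (hP0 : Mod P0)
  (hMod : nonparametric_at Mod P0)
  (hD : is_EIF Mod Psi P0 D)
  (hiid : iid P0 Obs)
  (hdecomp : forall n : nat, (0 < n)%N -> {ae P, forall w,
     psi_hat Obs est n w - Psi P0 = D_bar Obs D n w + Rrem n w})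
  (hD0 : L20 P0 D)
  (hsigma : (0 < 'E_P0[fun x => (D x ^+ 2)%R] < +oo)%E)
  (hbounded : {ae P0, forall x, `|D x| <= M})
  (hRrem : bigO_proba Rrem (fun n => (Num.sqrt n%:R)^-1))
  (hr : forall n : nat, (0 < n)%N ->
     {ae P, forall w, Rrem n w = r n * xi n w})
  (hxi : bigO_proba xi (fun _ => 1))
  (hboot : pairs_bootstrap Obs idx)
  (hmoment : (ereal_sup (range (fun n : nat =>
     'E_P[fun w => (T_stat Obs est (Psi P0) n w ^+ 2)%R])) < +oo)%E)
  (hlaw : forall n : nat, (0 < n)%N ->
     is_cond_law P (data_sigma Obs n) (T_boot Obs idx est n 0)
       (Tboot_law n))
  (hd2 : cvg_proba0 P (fun n w =>
     mallows2 (Tboot_law n w) (pushforward P (T_stat Obs est (Psi P0) n)))) :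
  (forall B : nat -> nat, B n @[n --> \oo] --> \oo ->
     cvg_proba0 P (fun n w =>
       ((var_boot Obs idx est n (B n) w)%:E
        - 'V_P[fun w' => (psi_hat Obs est n w' - Psi P0)%R])%E)) /\
  (forall n : nat, (0 < n)%N ->
     'V_P[fun w => (psi_hat Obs est n w - Psi P0)%R]
     = ('E_P0[fun x => (D x ^+ 2)%R] * (n%:R^-1)%:E + 'V_P[Rrem n]
        + 2%:E * covariance P (D_bar Obs D n) (Rrem n))%E).
Proof.
have [s Ts] : exists s : R, forall n,
    ('E_P[fun w => (T_stat Obs est (Psi P0) n w ^+ 2)%R] <= s%:E)%E.
  set S := ereal_sup _ in hmoment.
  have TS n : ('E_P[fun w => (T_stat Obs est (Psi P0) n w ^+ 2)%R] <= S)%E.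
    by apply: ereal_sup_ubound; exists n.
  (* The supremum is a real number: it is below +oo by hypothesis and dominates a nonnegative
     expectation. *)
  exists (fine S) => n; rewrite fineK// ge0_fin_numE//.
  by rewrite (le_trans _ (TS 0))// expectation_ge0// => w; exact: sqr_ge0.
split=> [B Boo|n n0]; first exact: (var_boot_consistent hboot Ts hlaw hd2 Boo).
set Z := fun w => psi_hat Obs est n w - Psi P0.
have [Z2 _] := psi_hat_Lfun2 n0 (Ts n).
have D2 : D_bar Obs D n \in Lfun P 2%:E := Lfun2_D_bar hiid hD0 n.
(* Square integrability of the remainder follows from the decomposition: almost surely it is a
   difference of two L^2 variables. *)
have R2 : (Rrem n : Om -> R) \in Lfun P 2%:E.
  apply: (@eq_Lfun2_ae _ _ _ _ _ (Z \- D_bar Obs D n)%R) => //.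
    by apply: filterS (hdecomp n n0) => w; rewrite /Z /= => ->; rewrite addrC addKr.
  by rewrite rpredB ?lee1n.
rewrite (@eq_variance_ae _ _ _ P Z (D_bar Obs D n \+ Rrem n)%R).
- by rewrite varianceD// (variance_D_bar hiid hD0).
- exact: Lfun_measurable Z2.
- by apply: measurable_funD => //; exact: Lfun_measurable D2.
- exact: hdecomp.
Qed.
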